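(* Let $P_n^\ell$ denote the Legendre–Gegenbauer polynomials, $D$ differentiation, $X$ multiplication by $x$, and $R=X^2-1$. Then for integers $n\ge0$ and real $\ell$ (with $P_{-1}^{\ell}=0$) the following relations hold. (i) Three term recurrence relation: $$(n+1)P_{n+1}^\ell+(n+\ell-1)P_{n-1}^\ell=(2n+\ell)XP_n^\ell.$$ (ii) Three-point-rules: $$(n+\ell)P_n^\ell=(XD+n+\ell)P_n^\ell-XDP_n^\ell=\ell P_n^{\ell+2}-\ell XP_{n-1}^{\ell+2},$$ $$nXP_n^\ell=(nX-RD)P_n^\ell+RDP_n^\ell=(n+\ell-1)P_{n-1}^\ell+\ell RP_{n-1}^{\ell+2},$$ $$(n+\ell)XP_n^\ell=\bigl((n+\ell)X+RD\bigr)P_n^\ell-RDP_n^\ell=(n+1)P_{n+1}^\ell-\ell RP_{n-1}^{\ell+2},$$ $$(\ell-1)(\ell-2)XP_n^\ell=(\ell-2)[(\ell-1)X+RD]P_n^\ell-(\ell-2)RDP_n^\ell=(n+1)(n+\ell-1)P_{n+1}^{\ell-2}-\ell(\ell-2)RP_{n-1}^{\ell+2}.$$ (iii) Rodrigues formula: for every positive integer $n$ and every odd positive integer $\ell$, $$P_n^\ell=\frac{(\ell+2n-2)(\ell+2n-4)\cdots\ell}{(\ell+2n-1)(\ell+2n-2)\cdots(\ell+n)\cdot n!}\;R^{-\frac{\ell-1}2}\,D^n\,R^{\,n+\frac{\ell-1}2}\,1,$$ where $1$ is the constant function and $R^{-\frac{\ell-1}{2}}$ is multiplication by $(x^2-1)^{-\frac{\ell-1}2}$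 (for $x\neq\pm1$).
   Context: For $n\in\mathbb N_0$ and $\ell\in\mathbb R$ the Legendre–Gegenbauer polynomial is $$P_n^\ell(x)=\sum_{j=0}^{\lfloor n/2\rfloor}(-1)^j\frac{\Gamma(n+\frac\ell2-j)}{\Gamma(\frac\ell2)\,j!\,(n-2j)!}(2x)^{n-2j},$$ where the quotient $\Gamma(n+\frac\ell2-j)/\Gamma(\frac\ell2)$ is understood as the product $\frac\ell2(\frac\ell2+1)\cdots(\frac\ell2+n-j-1)$ (empty product $=1$). The operators act on polynomials (or smooth functions) in $x$: $D=d/dx$, $X$ is multiplication by $x$, $R$ is multiplication by $x^2-1$. In (iii) the numerator product has $n$ factors $\ell+2n-2i$, $i=1,\dots,n$, and the product $(\ell+2n-1)\cdots(\ell+n)$ consists of the $n$ consecutive integers from $\ell+n$ to $\ell+2n-1$. *)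

(* Defs.v *)
From mathcomp Require Import all_boot all_order all_algebra.
From mathcomp Require Import reals.

Set Implicit Arguments.
Unset Strict Implicit.
Unset Printing Implicit Defensive.

Import Order.TTheory GRing.Theory Num.Theory.
Local Open Scope ring_scope.

Section LegendreGegenbauer.
Variable R : realType.

Definition rising (a : R) (k : nat) : R := \prod_(i < k) (a + i%:R).

(* [rising (l / 2) (n - j)] is the quotient Gamma(n + l/2 - j) / Gamma(l/2),
   read as a product so that it makes sense for every real [l]. *)
Definition legendre_nat (l : R) (n : nat) : {poly R} :=
  \sum_(j < (n./2).+1)
    ((-1) ^+ j * (rising (l / 2) (n - j) / (j`!%:R * (n - 2 * j)`!%:R)))
      *: (2%:R *: 'X) ^+ (n - 2 * j).

(* The degree is an [int] so that index n - 1 is meaningful at n = 0. *)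
Definition legendre (l : R) (n : int) : {poly R} :=
  match n with
  | Posz k => legendre_nat l k
  | Negz _ => 0
  end.

Definition opD (p : {poly R}) : {poly R} := p^`().
Definition opX (p : {poly R}) : {poly R} := 'X * p.
Definition opR (p : {poly R}) : {poly R} := ('X^2 - 1) * p.

End LegendreGegenbauer.

(* Main.v *)
(* Only the identity P_(n+1)' = l P_n^(l+2) and the three-term recurrence are
   checked on coefficients.  Differentiating the recurrence gives, by a joint
   induction, the two relations
     x P_(n+1)' - P_n' = (n+1) P_(n+1)  and  P_(n+1)' = x P_n' + (n+l) P_n,
   from which the three-point rules and the differential equation
     (x^2-1) P_n'' + (l+1) x P_n' = n (n+l) P_n
   follow by elimination.  Read through P_(n+1)' = l P_n^(l+2), the differential
   equation says that D maps (x^2-1)^(m+1) P_n^(l+2) to a multiple of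
   (x^2-1)^m P_(n+1)^l when l = 2m+1; iterating this from
   (x^2-1)^(m+n) P_0^(l+2n) yields the Rodrigues formula. *)
Require Import Defs.
From mathcomp Require Import all_boot all_order all_algebra.
From mathcomp Require Import reals.
From mathcomp Require Import ring zify.

Set Implicit Arguments.
Unset Strict Implicit.
Unset Printing Implicit Defensive.

Import Order.TTheory GRing.Theory Num.Theory.
Local Open Scope ring_scope.

(** * Coefficients, the derivative and the three-term recurrence *)

Lemma risingS (R : realType) (a : R) k : rising a k.+1 = rising a k * (a + k%:R).
Proof. by rewrite /rising big_ord_recr. Qed.

Lemma natr_factS (R : pzSemiRingType) k : k.+1`!%:R = k.+1%:R * k`!%:R :> R.
Proof. by rewrite factS natrM. Qed.

Lemma risingSl (R : realType) (a : R) k : rising a k.+1 = a * rising (a + 1) k.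
Proof.
rewrite /rising big_ord_recl addr0; congr (_ * _).
by apply: eq_bigr => i _; rewrite /= /bump /= natrD addrA.
Qed.

(** Writing the degree as [k + 2 * j] makes [j] the only summand that reaches the power [k], and
    avoids truncated subtraction. *)
Lemma coef_legendre_nat (R : realType) (l : R) (j k : nat) :
  (legendre_nat l (k + 2 * j))`_k
  = (-1) ^+ j * (rising (l / 2) (k + j) / (j`!%:R * k`!%:R)) * 2 ^+ k.
Proof.
rewrite /legendre_nat coef_sum.
have hj : (j < ((k + 2 * j)./2).+1)%N by lia.
rewrite (bigD1 (Ordinal hj)) //= big1 ?addr0 => [|i /eqP neq_ij].
  have -> : (k + 2 * j - 2 * j = k)%N by lia.
  have -> : (k + 2 * j - j = k + j)%N by lia.
  by rewrite coefZ exprZn coefZ coefXn eqxx mulr1.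
rewrite coefZ exprZn coefZ coefXn.
have /negbTE-> : k != (k + 2 * j - 2 * i)%N; last by rewrite !mulr0.
apply/eqP => h; apply: neq_ij; apply/val_inj => /=.
have := ltn_ord i; lia.
Qed.

Lemma coef_legendre_nat0 (R : realType) (l : R) (n k : nat) :
  (forall j, n <> (k + 2 * j)%N) -> (legendre_nat l n)`_k = 0.
Proof.
move=> hn; rewrite /legendre_nat coef_sum big1 // => i _.
rewrite coefZ exprZn coefZ coefXn.
have /negbTE-> : k != (n - 2 * i)%N; last by rewrite !mulr0.
by apply/eqP => h; apply: (hn i); have := ltn_ord i; lia.
Qed.

(** Case split for comparing coefficients: either the closed form applies, or the coefficient is
    zero by parity or because [k] exceeds [n]. *)
Lemma parity_dec (n k : nat) :
  (exists j, n = (k + 2 * j)%N) \/ (forall j, n <> (k + 2 * j)%N).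
Proof.
case: (boolP ((k <= n)%N && ~~ odd (n - k))) => h; [left | right => j]; last lia.
by exists ((n - k)./2); lia.
Qed.

Lemma legendre_nat_0 (R : realType) (l : R) : legendre_nat l 0 = 1.
Proof.
by rewrite /legendre_nat big_ord_recl big_ord0 /rising big_ord0 /= !mul1r invr1
  scale1r addr0 expr0.
Qed.

Lemma legendre_nat_1 (R : realType) (l : R) : legendre_nat l 1 = l *: 'X.
Proof.
rewrite /legendre_nat big_ord_recl big_ord0 risingS /rising big_ord0 /=.
rewrite addr0 expr1 scalerA; congr (_ *: _).
rewrite !subn0 fact0 factS fact0 expr0 !mul1r. by field.
Qed.

(** Raising [l] by 2 shifts [l / 2] by 1, so the rising product loses its front factor [l / 2]; with
    the extra 2 from [2 ^+ k.+1] this gives [l]. *)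
Lemma deriv_legendre_nat (R : realType) (l : R) n :
  (legendre_nat l n.+1)^`() = l *: legendre_nat (l + 2) n.
Proof.
apply/polyP => k; rewrite coef_deriv coefZ.
have [[j ->]|hn] := parity_dec n k; last first.
  by rewrite !coef_legendre_nat0 ?mul0rn ?mulr0 // => j h; apply: (hn j); lia.
have -> : (k + 2 * j).+1 = (k.+1 + 2 * j)%N by lia.
rewrite !coef_legendre_nat addSn risingSl natr_factS -[LHS]mulr_natr.
have -> : (l + 2) / 2 = l / 2 + 1 by field.
rewrite exprS; field.
rewrite !pnatr_eq0 -!lt0n !fact_gt0 /=.
by rewrite nat1r pnatr_eq0.
Qed.

Lemma legendre_nat_rec (R : realType) (l : R) n :
  n.+2%:R *: legendre_nat l n.+2 + (n%:R + l) *: legendre_nat l n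
  = (2 * n.+1%:R + l) *: ('X * legendre_nat l n.+1).
Proof.
have factn0 m : m`!%:R != 0 :> R by rewrite pnatr_eq0 -lt0n fact_gt0.
have Sn0 m : m%:R + 1 != 0 :> R by rewrite natr1 pnatr_eq0.
apply/polyP => k; rewrite coefD !coefZ coefXM.
have [[j hj]|hn] := parity_dec n.+2 k; last first.
  rewrite (coef_legendre_nat0 _ hn) (@coef_legendre_nat0 _ _ n k) => [|j h]; last first.
    by apply: (hn j.+1); lia.
  case: k hn => [|k] hn; rewrite ?mulr0 ?addr0 ?mulr0 //=.
  by rewrite coef_legendre_nat0 ?mulr0 // => j h; apply: (hn j); lia.
have en : n.+2%:R = k%:R + 2 * j%:R :> R by rewrite hj natrD natrM.
have e0 : n%:R = k%:R + 2 * j%:R - 2 :> R by rewrite -en -addn2 natrD addrK.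
have e1 : n.+1%:R = k%:R + 2 * j%:R - 1 :> R by rewrite -en -!natr1; ring.
rewrite en e0 e1 hj coef_legendre_nat.
(* For [j = 0] the power [k = n + 2] lies above the degree of [legendre_nat l n]. *)
case: j hj en e0 e1 => [|j] hj en e0 e1.
  rewrite (@coef_legendre_nat0 _ _ n) => [|j h]; last lia.
  case: k hj en e0 e1 => [|k] hj en e0 e1; first by lia.
  have -> : n.+1 = (k + 2 * 0)%N by lia.
  rewrite /= coef_legendre_nat !addn0 risingS natr_factS !exprS -(natr1 k).
  by field; rewrite ?factn0 ?Sn0.
have -> : n = (k + 2 * j)%N by lia.
rewrite coef_legendre_nat.
(* The constant coefficient gets nothing from the product with ['X]. *)
case: k hj en e0 e1 => [|k] hj en e0 e1.
  rewrite eqxx !add0n risingS natr_factS !exprS -(natr1 j).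
  by field; rewrite ?factn0 ?Sn0.
have -> : (k.+1 + 2 * j).+1 = (k + 2 * j.+1)%N by lia.
rewrite /= coef_legendre_nat !addSn !addnS !risingS !natr_factS.
rewrite !exprS -(natr1 j) -(natr1 k) !natrD.
by field; rewrite ?factn0 ?Sn0.
Qed.

(** * Contiguous relations and the differential equation *)

Section ContiguousRelations.
Variables (R : realType) (l : R).
Implicit Type n : nat.

Let p n := legendre_nat l n.
(** As a constant polynomial, [l] lets [ring] work inside [{poly R}]. *)
Let c : {poly R} := l%:P.

Lemma legendre_nat_recC n :
  n.+2%:R * p n.+2 + (n%:R + c) * p n = (2 * n.+1%:R + c) * ('X * p n.+1).
Proof.
by have := legendre_nat_rec l n; rewrite -!mul_polyC !polyCD polyCM !polyC_natr.
Qed.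

Lemma legendre_nat_deriv_rec n :
  'X * (p n.+1)^`() - (p n)^`() = n.+1%:R * p n.+1
  /\ (p n.+1)^`() = 'X * (p n)^`() + (n%:R + c) * p n.
Proof.
elim: n => [|n [IHe IHf]].
  rewrite /p legendre_nat_1 legendre_nat_0 -mul_polyC derivM !derivC derivX.
  by split; rewrite /c; ring.
have rec := legendre_nat_recC n.
have drec : n.+2%:R * (p n.+2)^`() + (n%:R + c) * (p n)^`()
    = (2 * n.+1%:R + c) * (p n.+1 + 'X * (p n.+1)^`()).
  move/(congr1 (@deriv R)): rec.
  have dK k : (k%:R : {poly R})^`() = 0 by rewrite -polyC_natr derivC.
  by rewrite !(derivD, derivM, derivX, derivC, dK) !(mul0r, mulr0, add0r, mul1r).
have up : (p n.+2)^`() = 'X * (p n.+1)^`() + (n.+1%:R + c) * p n.+1.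
  apply: (@mulfI _ n.+2%:R); first by rewrite -polyC_natr polyC_eq0 pnatr_eq0.
  have IHe' : (p n)^`() = 'X * (p n.+1)^`() - n.+1%:R * p n.+1 by rewrite -IHe; ring.
  rewrite -[LHS](addrK ((n%:R + c) * (p n)^`())) drec IHe' -!natr1; ring.
split=> //; rewrite up.
have -> : n.+2%:R * p n.+2
    = (2 * n.+1%:R + c) * ('X * p n.+1) - (n%:R + c) * p n by rewrite -rec addrK.
have -> : 'X * ('X * (p n.+1)^`() + (n.+1%:R + c) * p n.+1) - (p n.+1)^`()
  = 'X * ('X * (p n.+1)^`() - (p n)^`()) + 'X * (p n)^`()
    + 'X * (n.+1%:R + c) * p n.+1 - (p n.+1)^`() by ring.
rewrite IHe IHf; ring.
Qed.

Lemma legendre_succ n : legendre l (n%:Z + 1) = p n.+1.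
Proof. by have -> : n%:Z + 1 = n.+1%:Z by lia. Qed.

Lemma legendre_pred n : legendre l (n.+1%:Z - 1) = p n.
Proof. by have -> : n.+1%:Z - 1 = n%:Z by lia. Qed.

(** The predecessor of [p n], equal to 0 at [n = 0]. *)
Let q n := legendre l (n%:Z - 1).

Lemma three_term n :
  n.+1%:R * p n.+1 + (n%:R + c - 1) * q n = (2 * n%:R + c) * ('X * p n).
Proof.
case: n => [|n].
  by rewrite /q /p legendre_nat_0 legendre_nat_1 /= -mul_polyC; ring.
by rewrite /q legendre_pred -legendre_nat_recC -(natr1 n); ring.
Qed.

(** Multiply the first relation of [legendre_nat_deriv_rec] by ['X] and insert the second: the terms
    in the derivative of the lower polynomial cancel. *)
Lemma legendre_nat_mulX n :
  n%:R * ('X * p n) = (n%:R + c - 1) * q n + ('X^2 - 1) * (p n)^`().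
Proof.
case: n => [|n].
  by rewrite /q /p legendre_nat_0 /= derivC; ring.
rewrite /q legendre_pred.
have [down up] := legendre_nat_deriv_rec n.
have -> : n.+1%:R * ('X * p n.+1) = 'X * (n.+1%:R * p n.+1) by ring.
rewrite -down -(natr1 n).
have -> : (n%:R + 1 + c - 1) * p n = (p n.+1)^`() - 'X * (p n)^`() by rewrite up; ring.
ring.
Qed.

(** Differentiate [legendre_nat_mulX] and eliminate the derivative of [p n]. *)
Lemma legendre_nat_ode n :
  ('X^2 - 1) * (p n.+1)^`(2) + (1 + c) * ('X * (p n.+1)^`())
  = n.+1%:R * (n.+1%:R + c) * p n.+1.
Proof.
have [down _] := legendre_nat_deriv_rec n.
have := legendre_nat_mulX n.+1; rewrite /q legendre_pred => /(congr1 (@deriv R)).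
have dK k : (k%:R : {poly R})^`() = 0 by rewrite -polyC_natr derivC.
rewrite expr2 !(derivD, derivN, derivM, derivX, derivC, dK) -[_^`()^`()]/(_^`(2)).
have -> : (p n)^`() = 'X * (p n.+1)^`() - n.+1%:R * p n.+1 by rewrite -down; ring.
move=> h; apply/eqP; rewrite -subr_eq0; move/eqP: h; rewrite eq_sym -subr_eq0.
by congr (_ == 0); rewrite -(natr1 n); ring.
Qed.

End ContiguousRelations.

(** * Rodrigues formula *)

Lemma legendre_nat_raise (R : realType) (l : R) n :
  l *: ((l + 1) *: ('X * legendre_nat (l + 2) n)
        + ('X^2 - 1) * (legendre_nat (l + 2) n)^`())
  = (n.+1%:R * (n.+1%:R + l)) *: legendre_nat l n.+1.
Proof.
have := legendre_nat_ode l n.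
rewrite derivSn derivn1 deriv_legendre_nat derivZ.
rewrite -!mul_polyC !(polyCD, polyCM) !polyC_natr => <-; ring.
Qed.

(** The second factor has the shape of the bracket in [legendre_nat_raise] at [l = 2 * m + 1]. *)
Lemma derivM_exp_X2sub1 (R : realType) (f : {poly R}) m :
  (('X^2 - 1) ^+ m.+1 * f)^`()
  = ('X^2 - 1) ^+ m * (((2 * m + 1)%:R + 1) *: ('X * f) + ('X^2 - 1) * f^`()).
Proof.
rewrite derivM deriv_exp /= derivB derivXn derivC subr0 /= expr1.
rewrite -mul_polyC polyCD polyC_natr -[_ *+ m.+1]mulr_natr
  (exprS _ m) natrD natrM -(natr1 m) polyC1; ring.
Qed.

(** Denominators and the negative power are cleared to get a polynomial identity. Degree [n + 1] at
    [m] comes from differentiating degree [n] at [m + 1]; the exponent [n + m] is unchanged. *)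
Lemma rodrigues (R : realType) n m :
  ((\prod_((2 * m + 1) + n <= k < (2 * m + 1) + 2 * n) k%:R) * n`!%:R)
    *: (('X^2 - 1) ^+ m * legendre_nat (2 * m + 1)%:R n)
  = (\prod_(1 <= i < n.+1) ((2 * m + 1)%:R + 2 * n%:R - 2 * i%:R))
    *: (('X^2 - 1) ^+ (n + m))^`(n) :> {poly R}.
Proof.
elim: n m => [|n IHn] m.
  by rewrite muln0 addn0 !big_geq // mul1r legendre_nat_0 mulr1.
have el : (2 * m + 1)%:R + 2 = (2 * m.+1 + 1)%:R :> R.
  by rewrite -natrD; congr _%:R; lia.
set l := (2 * m + 1)%N in el *; set l' := (2 * m.+1 + 1)%N in el IHn *.
(* The last numerator factor, [i = n + 1], is [l] itself. *)
rewrite big_nat_recr //= addrK.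
have -> : \prod_(1 <= i < n.+1) (l%:R + 2 * n.+1%:R - 2 * i%:R)
    = \prod_(1 <= i < n.+1) (l'%:R + 2 * n%:R - 2 * i%:R) :> R.
  by apply: eq_bigr => i _; rewrite -el -(natr1 n); ring.
(* The split-off factor [l + n + 1], with [n + 1] from the factorial, is the constant of
   [legendre_nat_raise]. *)
rewrite big_ltn; last lia.
have -> : (l + n.+1).+1 = (l' + n)%N by lia.
have -> : (l + 2 * n.+1)%N = (l' + 2 * n)%N by lia.
have := congr1 (fun f => l%:R *: f^`()) (IHn m.+1).
rewrite !derivZ derivM_exp_X2sub1 -/l -/l' -derivnS -addSnnS.
rewrite [RHS]scalerA [l%:R * _]mulrC => <-.
rewrite scalerA [l%:R * _]mulrC -[RHS]scalerA [X in _ = _ *: X]scalerAr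
  -el legendre_nat_raise -scalerAr scalerA.
by congr (_ *: _); rewrite natr_factS natrD; ring.
Qed.

(** * Assembly of the three groups of relations *)

Theorem theorem7 (R : realType) :
  (* (i) three term recurrence *)
  (forall (n : nat) (l : R),
     (n%:R + 1) *: legendre l (n%:Z + 1)
       + (n%:R + l - 1) *: legendre l (n%:Z - 1)
     = (2 * n%:R + l) *: opX (legendre l n%:Z))
  /\
  (* (ii) three-point rules *)
  (forall (n : nat) (l : R),
     let P := legendre l n%:Z in
     [/\ (n%:R + l) *: P
           = (opX (opD P) + (n%:R + l) *: P) - opX (opD P)
         /\ (opX (opD P) + (n%:R + l) *: P) - opX (opD P)
           = l *: legendre (l + 2) n%:Z
               - l *: opX (legendre (l + 2) (n%:Z - 1)),
         n%:R *: opX P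
           = (n%:R *: opX P - opR (opD P)) + opR (opD P)
         /\ (n%:R *: opX P - opR (opD P)) + opR (opD P)
           = (n%:R + l - 1) *: legendre l (n%:Z - 1)
               + l *: opR (legendre (l + 2) (n%:Z - 1)),
         (n%:R + l) *: opX P
           = ((n%:R + l) *: opX P + opR (opD P)) - opR (opD P)
         /\ ((n%:R + l) *: opX P + opR (opD P)) - opR (opD P)
           = (n%:R + 1) *: legendre l (n%:Z + 1)
               - l *: opR (legendre (l + 2) (n%:Z - 1))
       & ((l - 1) * (l - 2)) *: opX P
           = (l - 2) *: ((l - 1) *: opX P + opR (opD P))
               - (l - 2) *: opR (opD P)
         /\ (l - 2) *: ((l - 1) *: opX P + opR (opD P))
               - (l - 2) *: opR (opD P)
           = ((n%:R + 1) * (n%:R + l - 1)) *: legendre (l - 2) (n%:Z + 1)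
               - (l * (l - 2)) *: opR (legendre (l + 2) (n%:Z - 1))])
  /\
  (* (iii) Rodrigues formula *)
  (forall (n l : nat) (x : R),
     (0 < n)%N -> odd l -> x != 1 -> x != -1 ->
     (legendre l%:R n%:Z).[x]
     = (\prod_(1 <= i < n.+1) (l%:R + 2 * n%:R - 2 * i%:R))
         / ((\prod_(l + n <= k < l + 2 * n) k%:R) * n`!%:R)
       * ((x ^+ 2 - 1) ^- ((l - 1) %/ 2)
          * (iter n (@opD R) (iter (n + (l - 1) %/ 2) (@opR R) 1)).[x])).
Proof.
(* At [n = 0] both sides vanish, so no later rule needs that case apart. *)
have deriv_p n (l : R) : l *: legendre (l + 2) (n%:Z - 1) = (legendre_nat l n)^`().
  case: n => [|n]; first by rewrite scaler0 legendre_nat_0 derivC.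
  by rewrite legendre_pred deriv_legendre_nat.
have recZ (n : nat) (l : R) :
    (n%:R + 1) *: legendre l (n%:Z + 1) + (n%:R + l - 1) *: legendre l (n%:Z - 1)
    = (2 * n%:R + l) *: opX (legendre l n%:Z).
  rewrite /opX legendre_succ -!mul_polyC !(polyCD, polyCN, polyCM) !polyC_natr !polyC1.
  by have := three_term l n; rewrite -natr1.
have mulXZ (n : nat) (l : R) :
    n%:R *: opX (legendre l n%:Z)
    = (n%:R + l - 1) *: legendre l (n%:Z - 1) + opR (opD (legendre l n%:Z)).
  rewrite /opX /opR /opD -!mul_polyC !(polyCD, polyCN) !polyC_natr.
  exact: legendre_nat_mulX.
split; first exact: recZ.
split=> [n l P|n l x n_gt0 l_odd x_neq1 x_neqN1].
  have derP : opR (opD P) = l *: opR (legendre (l + 2) (n%:Z - 1)).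
    by rewrite /opR scalerAr deriv_p.
  split.
  - rewrite addrAC subrr add0r; split=> //.
    have [_] := legendre_nat_deriv_rec l n; rewrite deriv_legendre_nat => up.
    rewrite /opX scalerAr deriv_p [X in _ = X - _]up.
    by rewrite -mul_polyC polyCD polyC_natr addrAC subrr add0r.
  - by rewrite subrK mulXZ derP.
  - rewrite addrK; split=> //.
    have := recZ n l.
    (* Subtracting the second rule from the recurrence leaves the third. *)
    have -> : (2 * n%:R + l) *: opX P = n%:R *: opX P + (n%:R + l) *: opX P.
      by rewrite -scalerDl; congr (_ *: _); ring.
    rewrite mulXZ derP -/P [LHS]addrC -[RHS]addrA => /addrI ->.
    by rewrite addrAC subrr add0r.
  - split; first by rewrite scalerDr addrK scalerA [(l - 2) * _]mulrC.
    (* At [l - 2] the raised parameter is [l], that of [P]. *)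
    have := legendre_nat_raise (l - 2) n.
    have <- : (l - 2) *: opR (opD P) = (l * (l - 2)) *: opR (legendre (l + 2) (n%:Z - 1)).
      by rewrite derP scalerA mulrC.
    rewrite subrK legendre_succ -(natr1 n).
    have -> : l - 2 + 1 = l - 1 by ring.
    have -> : n%:R + 1 + (l - 2) = n%:R + l - 1 by ring.
    by move=> <-.
have [m el] : exists m, l = (2 * m + 1)%N by exists l./2; lia.
have -> : ((l - 1) %/ 2 = m)%N by lia.
have iterX k : iter k (@opR R) 1 = ('X^2 - 1) ^+ k.
  by elim: k => [|k IH]; rewrite ?expr0 //= IH (exprS _ k).
have x2n0 : x ^+ 2 - 1 != 0 by rewrite subr_eq0 sqrf_eq1 negb_or x_neq1.
have := congr1 (horner^~ x) (rodrigues R n m).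
rewrite -el /= !hornerZ hornerM !horner_exp !hornerD !hornerN !hornerXn !hornerC iterX.
(* Every [k] in the range is at least [l + n], which is positive. *)
have den_neq0 : \prod_(l + n <= k < l + 2 * n) k%:R * n`!%:R != 0 :> R.
  rewrite mulf_neq0 ?pnatr_eq0 -?lt0n ?fact_gt0 // big_seq prodf_seq_neq0.
  by apply/allP => k; rewrite mem_index_iota pnatr_eq0; lia.
rewrite -[iter _ _ _]/(_^`(n)) => h.
rewrite mulrAC [_ * (_ * _.[x])]mulrCA -h.
move: den_neq0; rewrite mulf_eq0 negb_or => /andP[prod_neq0 fact_neq0].
by field; rewrite prod_neq0 fact_neq0 expf_neq0.
Qed.
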